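(* Let $n\ge 1$, let $X_1,\dots,X_n$ be non-empty sets, let $S\subset X_1\times X_2\times\cdots\times X_n$, and let $f:S\to\mathbb{R}$ be a function such that, whenever $k\geq 1$, $\underline{x}^{1},\dots,\underline{x}^{k}\in S$ and $p_1,\dots,p_k\in\mathbb{Z}$ are such that the formal sum $\sum_{j=1}^k p_j\underline{x}^{j}$ is $0$, one has $\sum_{j=1}^k p_j f(\underline{x}^{j})=0$. Then there exist functions $u_i:X_i\to\mathbb{R}$, $1\le i\le n$, such that $$f(x_1,x_2,\dots,x_n)=u_1(x_1)+u_2(x_2)+\cdots+u_n(x_n)\quad\text{for all }(x_1,\dots,x_n)\in S.$$
   Context: For points $\underline{x}^{j}=(x_1^{j},\dots,x_n^{j})\in X_1\times\cdots\times X_n$ and integers $p_j$ ($1\le j\le k$), ''the formal sum $\sum_{j=1}^k p_j\underline{x}^{j}$ is $0$'' means that for each coordinate $i$, $1\le i\le n$, the formal integer combination $\sum_{j=1}^k p_j x_i^{j}$ of elements of $X_i$ vanishes, i.e. $\sum_{j=1}^k p_j\mathbf{1}_{\{x_i^{j}\}}=0$ as a function on $X_i$. (It is not a sum in any group structure on the $X_i$.) *)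

(* Defs.v *)
From mathcomp Require Import all_boot all_order all_algebra.
From mathcomp Require Import boolp classical_sets reals numfun.
Set Implicit Arguments.
Unset Strict Implicit.
Unset Printing Implicit Defensive.
Import Order.TTheory GRing.Theory Num.Theory.
Local Open Scope classical_set_scope.
Local Open Scope ring_scope.

(* [\1_[set a]] is the [int]-valued indicator function of [a]: the sum is the
   coefficient of [y] in the formal integer combination of the [i]-th
   coordinates. *)
Definition formal_sum_eq0 (n : nat) (X : 'I_n -> Type) (k : nat)
    (p : 'I_k -> int) (x : 'I_k -> forall i, X i) : Prop :=
  forall (i : 'I_n) (y : X i), \sum_(j < k) p j * \1_[set x j i] y = 0.

(* Main.v *)
Require Import Defs.
From HB Require Import structures.
From mathcomp Require Import all_boot all_order all_algebra.
From mathcomp Require Import boolp classical_sets functions reals numfun.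
Import Order.TTheory GRing.Theory Num.Theory.
Local Open Scope classical_set_scope.
Local Open Scope ring_scope.

(** Send a point s to the function e(s) = sum_i 1_(i, s_i) on the disjoint union
    of the X_i, with values in the integers. The hypothesis says that every
    integer relation between the e(s) is also satisfied by the f(s), so that
    e(s) |-> f(s) is a well-defined homomorphism on the subgroup spanned by the
    e(s). The reals are divisible, so by Zorn it extends to a homomorphism g on
    all integer-valued functions, and u_i(y) = g(1_(i, y)). *)

Definition subgroup {V : zmodType} (G : set V) : Prop :=
  G 0 /\ forall x y, G x -> G y -> G (x - y).

(** A homomorphism from a subgroup of [V] to [W], encoded by its graph. For a subgroup of [V * W],
    being single-valued can be tested at [0] alone. *)
Definition functional_graph {V W : zmodType} (G : set (V * W)) : Prop :=
  subgroup G /\ forall w, G (0, w) -> w = 0.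

Lemma mulrz_fctE {T : Type} {V : zmodType} (f : T -> V) (m : int) t :
  (f *~ m) t = f t *~ m.
Proof. by case: m => k; rewrite ?NegzE ?mulrNz /= -!pmulrn ?opprfctE natmulfctE. Qed.

Section Subgroup.
Context {V : zmodType} {G : set V} (sG : subgroup G).

Lemma subgroupN x : G x -> G (- x).
Proof. by move=> Gx; rewrite -[- x]add0r; apply: sG.2 => //; exact: sG.1. Qed.

Lemma subgroupD x y : G x -> G y -> G (x + y).
Proof. by move=> Gx Gy; rewrite -[y]opprK; apply: sG.2 => //; exact: subgroupN. Qed.

Lemma subgroupMz x (m : int) : G x -> G (x *~ m).
Proof.
move=> Gx.
have Mn k : G (x *+ k).
  by elim: k => [|k IH]; [exact: sG.1 | rewrite mulrS; exact: subgroupD].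
by case: m => k; [exact: Mn | rewrite NegzE mulrNz; exact/subgroupN/Mn].
Qed.

End Subgroup.

Lemma pair_mulrz {V W : zmodType} (z : V * W) (m : int) :
  z *~ m = (z.1 *~ m, z.2 *~ m).
Proof. by rewrite [LHS]surjective_pairing !raddfMz. Qed.

(** The chain condition for Zorn: by totality, any two elements of the union already lie in the
    union of [G0] with a single [A]. *)
Lemma functional_graphU {V W : zmodType} (G0 : set (V * W))
    (F : set (set (V * W))) :
  functional_graph G0 -> total_on F subset ->
  (forall A, F A -> functional_graph (A `|` G0)) ->
  functional_graph (\bigcup_(A in F) A `|` G0).
Proof.
move=> fG0 totF fF; split; last first.
  by move=> w [[A FA Aw]|]; [apply: (fF A FA).2; left | exact: fG0.2].
split; first by right; exact: fG0.1.1.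
have inU A z : F A -> (A `|` G0) z -> (\bigcup_(A in F) A `|` G0) z.
  by move=> FA [Az|]; [left; exists A | right].
move=> x y [[A FA Ax]|G0x] [[B FB By]|G0y].
- case: (totF A B FA FB) => [AB|BA].
  + by apply: (inU B) => //; apply: (fF B FB).1.2; left => //; exact: AB.
  + by apply: (inU A) => //; apply: (fF A FA).1.2; left => //; exact: BA.
- by apply: (inU A) => //; apply: (fF A FA).1.2; [left|right].
- by apply: (inU B) => //; apply: (fF B FB).1.2; [right|left].
- by right; exact: fG0.1.2.
Qed.

(* [c] is the value a homomorphism extending [G] may take at [v]: it is forced to
   be [r / m] if [G (v *~ m, r)] for some [m != 0], and is arbitrary otherwise. *)
Lemma functional_graph_slope {V : zmodType} {R : numFieldType}
    (G : set (V * R)) (v : V) : functional_graph G ->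
  exists c : R, forall (m : int) r, G (v *~ m, r) -> r = c *~ m.
Proof.
move=> [sG fG].
have [[m [r [m0 Gr]]]|no] :=
  pselect (exists m : int, exists r, m != 0 /\ G (v *~ m, r)).
  exists (r / m%:~R) => m' r' Gr'.
  (* Cross-multiplication: [m] times the new pair minus [m'] times the old one has first coordinate
     [0]. *)
  have /fG/eqP : G (0, r' *~ m - r *~ m').
    have := sG.2 _ _ (subgroupMz sG _ m Gr') (subgroupMz sG _ m' Gr).
    rewrite !pair_mulrz /=.
    by rewrite -!mulrzA [m' * m]mulrC -[X in G X]/(_ - _, _ - _) subrr.
  rewrite subr_eq0 -mulrzr -[r *~ _]mulrzr => /eqP e.
  have mR : m%:~R != 0 :> R by rewrite intr_eq0.
  by rewrite -mulrzr mulrAC -e mulfK.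
exists 0 => m r Gr; rewrite mul0rz.
have [m0|m0] := eqVneq m 0; first by apply: fG; move: Gr; rewrite m0.
by case: no; exists m, r.
Qed.

Lemma functional_graph_extend {V : zmodType} {R : numFieldType}
    (G : set (V * R)) (v : V) : functional_graph G ->
  exists H, [/\ functional_graph H, G `<=` H & exists c, H (v, c)].
Proof.
move=> fG; have [c cP] := @functional_graph_slope _ _ _ v fG.
have [sG f0] := fG.
(* The subgroup generated by [G] and [(v, c)]. *)
exists [set z | exists m : int, G (z - (v, c) *~ m)]; split.
- split; first split.
  + by exists 0; rewrite mulr0z subr0; exact: sG.1.
  + move=> x y [m Gx] [m' Gy]; exists (m - m').
    suff -> : x - y - (v, c) *~ (m - m') = (x - (v, c) *~ m) - (y - (v, c) *~ m').
      exact: sG.2.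
    by rewrite mulrzBr [in RHS]opprD [RHS]addrACA -opprD.
  (* Here [G] contains [(v *~ - m, w - c *~ m)], so the choice of [c] gives
     [w - c *~ m = - (c *~ m)]. *)
  + move=> w [m]; rewrite pair_mulrz /= -[X in G X]/(0 - _, w - _) sub0r.
    rewrite -mulrNz => /cP /eqP; rewrite mulrNz subr_eq addNr.
    by move/eqP.
- by move=> z Gz; exists 0; rewrite mulr0z subr0.
- by exists c, 1; rewrite mulr1z subrr; exact: sG.1.
Qed.

(* Injectivity of the divisible group [R]. *)
Lemma functional_graph_additive {V : zmodType} {R : numFieldType}
    (G0 : set (V * R)) : functional_graph G0 ->
  exists g : {additive V -> R}, forall v r, G0 (v, r) -> g v = r.
Proof.
move=> fG0.
(* The empty chain has union [set0], so Zorn is applied to sets [A] up to the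
   union with [G0]. *)
have [A [fA maxA]] : exists A, functional_graph (A `|` G0) /\
    forall B, A `<` B -> ~ functional_graph (B `|` G0).
  apply: (@Zorn_bigcup _ [set A | functional_graph (A `|` G0)]) => F FP totF.
  exact: functional_graphU.
have total v : exists r, (A `|` G0) (v, r).
  have [H [fH GH [c Hc]]] := @functional_graph_extend _ _ _ v fA.
  have HU : H `|` G0 = H by apply/setUidPl => z G0z; apply: GH; right.
  (* Otherwise [H] would be strictly larger than [A], against maximality. *)
  have [HA|nHA] := pselect (H `<=` A); first by exists c; left; exact: HA.
  case: (maxA H); last by rewrite HU.
  by split => // z Az; apply: GH; left.
have [g gP] := choice total.
have gE v r : (A `|` G0) (v, r) -> g v = r.
  move=> vr; apply/eqP; rewrite -subr_eq0; apply/eqP/fA.2.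
  by have := fA.1.2 _ _ (gP v) vr; rewrite -[X in (_ `|` _) X]/(_ - _, _ - _) subrr.
have gB : zmod_morphism g by move=> x y; apply: gE; exact: fA.1.2 (gP x) (gP y).
pose gA : {additive V -> R} :=
  HB.pack g (GRing.isZmodMorphism.Build _ _ g gB).
by exists gA => v r G0vr; apply: gE; right.
Qed.

Lemma additive_of_relations {V : zmodType} {R : numFieldType} {I : Type}
    (e : I -> V) (f : I -> R) :
  (forall (k : nat) (x : 'I_k -> I) (p : 'I_k -> int),
    \sum_(j < k) e (x j) *~ p j = 0 -> \sum_(j < k) f (x j) *~ p j = 0) ->
  exists g : {additive V -> R}, forall i, g (e i) = f i.
Proof.
move=> rel.
(* The range of [comb] is the subgroup generated by the pairs [(e i, f i)]; [rel] says exactly that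
   it is a functional graph. *)
pose comb (s : seq (I * int)) : V * R :=
  (\sum_(a <- s) e a.1 *~ a.2, \sum_(a <- s) f a.1 *~ a.2).
have [|g gP] := @functional_graph_additive _ _ (range comb).
- split; first split.
  + by exists [::] => //; rewrite /comb !big_nil.
  + move=> _ _ [s _ <-] [t _ <-]; exists (s ++ [seq (a.1, - a.2) | a <- t]) => //.
    rewrite /comb !big_cat !big_map /= -[RHS]/(_ - _, _ - _) -!sumrN.
    by congr (_ + _, _ + _); apply: eq_bigr => a _; rewrite mulrNz.
  + move=> w [s _ [s0 <-]]; rewrite big_tnth in s0; rewrite big_tnth.
    exact: (rel _ (fun j => (tnth (in_tuple s) j).1)
                  (fun j => (tnth (in_tuple s) j).2)).
by exists g => i; apply: gP; exists [:: (i, 1)]; rewrite // /comb !big_seq1.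
Qed.

(** At a point with tag [i] only the [i]-th summand can be nonzero. Relations between the [e s] can
    thus be read coordinate by coordinate, as in [formal_sum_eq0]. *)
Lemma indic_tagged_sum (R : pzRingType) (n : nat) (X : 'I_n -> Type)
    (x : forall i, X i) :
  \sum_(i < n) (\1_[set Tagged X (x i)] : {i & X i} -> R) =
  (fun t => \1_[set x (tag t)] (tagged t)).
Proof.
apply/funext => -[i y] /=; rewrite fct_sumE (bigD1 i) //= big1 ?addr0.
  rewrite !indicE; congr (_%:R); congr nat_of_bool.
  apply: asbool_equiv_eq; split => [/= e|/= ->//].
  exact: (existT_inj2 e).
move=> j ji; rewrite indicE memNset // => -[/= ij _].
by rewrite ij eqxx in ji.
Qed.

Theorem theorem1p1 (R : realType) (n : nat) (hn : (1 <= n)%N)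
    (X : 'I_n -> Type) (hX : forall i, inhabited (X i))
    (S : set (forall i, X i)) (f : S -> R)
    (hf : forall (k : nat) (x : 'I_k -> S) (p : 'I_k -> int),
        (1 <= k)%N -> formal_sum_eq0 p (fun j => val (x j)) ->
        \sum_(j < k) (p j)%:~R * f (x j) = 0) :
  exists u : forall i, X i -> R,
    forall s : S, f s = \sum_(i < n) u i (val s i).
Proof.
pose e (s : S) : {i & X i} -> int :=
  \sum_(i < n) \1_[set Tagged X (val s i)].
have [k x p rel|g gE] := @additive_of_relations _ R S e f.
  under eq_bigr do rewrite -mulrzl.
  (* [hf] covers only [1 <= k]; for [k = 0] the sum is empty. *)
  case: k x p rel => [|k] x p rel; first by rewrite big_ord0.
  apply: hf => // i y; rewrite -[RHS](congr1 (@^~ (Tagged X y)) rel) fct_sumE.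
  apply: eq_bigr => j _; by rewrite /e indic_tagged_sum mulrz_fctE /= -mulrzl intz.
exists (fun i y => g (\1_[set Tagged X y])) => s.
by rewrite -gE raddf_sum.
Qed.
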